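(* Let $\mathcal{X}$ be the token vocabulary, let $\mathcal{M}_s$ (draft model) and $\mathcal{M}_b$ (target model) be autoregressive distributions over $\mathcal{X}$, let $X_0$ be a prefix, and let $T$ be a decoding tree rooted at $X_0$ based on $\mathcal{M}_s$ (children sampled with or without replacement). Then Traversal Verification is a valid tree verification algorithm. That is, its output $(X^\tau,Y)$ on input $(T,\mathcal{M}_s,\mathcal{M}_b)$ satisfies $$(X^\tau,Y)\sim\mathcal{M}_b(\cdot\mid X_0),$$ with the convention $\mathcal{M}_b(X_0\mid X_0)=1$. Since the output has variable length, this means the following: if $(X_0,X_1,\dots,X_\tau,Y)$ is continued autoregressively by sampling from $\mathcal{M}_b(\cdot\mid X^\tau,Y)$ to a sequence $(Z_0,Z_1,Z_2,\dots)$ with $Z_0=X_0$, then for every $n\ge 1$ and all $z_1,\dots,z_n\in\mathcal{X}$, $$\mathbb{P}(Z_1=z_1,\dots,Z_n=z_n)=\prod_{i=1}^n\mathcal{M}_b(z_i\mid X_0,z_1,\dots,z_{i-1}).$$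
   Context: **Models.** $\mathcal{X}$ is the set of tokens. An autoregressive distribution $\mathcal{M}$ assigns to each finite sequence $x^i=(x_0,x_1,\dots,x_i)$ (with $x_0=X_0$ the prefix and $x_1,\dots,x_i\in\mathcal{X}$) a probability distribution $\mathcal{M}(\cdot\mid x^i)$ on $\mathcal{X}$. Write $[t]_+=\max\{t,0\}$. **Decoding tree.** A decoding tree based on $\mathcal{M}_s$ is a finite tree $T$ rooted at $X_0$, whose non-root nodes carry tokens, such that for every chain $v=(X_0,\dots,X_{\gamma_v})\subset T$ (path of nodes starting at the root; $\gamma_v$ is its depth) all child nodes of the last node of $v$ are generated according to the conditional distribution $\mathcal{M}_s(\cdot\mid v)$, with or without replacement. (With replacement: each child is drawn from $\mathcal{M}_s(\cdot\mid v)$. Without replacement: after each draw the probability of the drawn token is set to $0$ and the distribution is renormalized.) The children of a node are ordered in the order in which they are drawn. For a node $u$, write $t_u$ for its token and $x^u$ for the sequence of labels from the root to $u$. **Tree verification algorithm.** A (randomized) procedure that takes as input the tree $T$ and, for all chains $v=(X_0,\dots,X_{\gamma_v})\subset T$, the draft distributions $\mathcal{M}_s(\cdot\mid X^i)$, $i<\gamma_v$, and the target distributions $\mathcal{M}_b(\cdot\mid X^i)$, $i\le\gamma_v$, where $X^i=(X_0,\dots,X_i)$. It outputs an accepted chain $X^\tau=(X_0,\dots,X_\tau)\subset T$, with $\tau\le\max_{v\subset T}\gamma_v$, and an additional token $Y$. It is called valid if its output satisfies $(X^\tau,Y)\sim\mathcal{M}_b(\cdot\mid X_0)$. Probabilities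 are over the random tree, the internal randomness of the algorithm, and the continuation. **Traversal Verification.** The algorithm maintains, for each node $v$, an acceptance rate $p(v)$, a current target distribution $B_v$ and (if $v$ has children) a current draft distribution $D_v$. 1. Initialize $B_v=\mathcal{M}_b(\cdot\mid x^v)$ and $D_v=\mathcal{M}_s(\cdot\mid x^v)$ for all $v$; $p(\mathrm{root})=1$; and recursively, for each child $u$ of $v$, $$p(u)=\min\Big\{p(v)\frac{B_v(t_u)}{D_v(t_u)},\,1\Big\}.$$ Set $\tau=0$. 2. While the tree is nonempty: let $u$ be the first leaf of the current tree (start at the root and repeatedly move to the first remaining child), and sample a fresh $\eta\sim U(0,1)$. - If $\eta<p(u)$: let $\tau$ be the depth of $u$, set $X^\tau=x^u$, and leave the loop. - Otherwise: let $v$ be the parent of $u$, delete $u$ from the tree, and with $S=\sum_{x\in\mathcal{X}}[p(v)B_v(x)-D_v(x)]_+$ (computed from the current values) simultaneously replace $$B_v(x)\leftarrow\frac{[p(v)B_v(x)-D_v(x)]_+}{S}\ \ (x\in\mathcal{X}),\qquad p(v)\leftarrow\frac{S}{S+1-p(v)},$$ $$D_v(t_u)\leftarrow 0,\qquad D_v(x)\leftarrow\frac{D_v(x)}{1-D_v(t_u)}\ \ (x\ne t_u).$$ Then recompute, from $v$ downwards, $p(w')=\min\{p(w)B_w(t_{w'})/D_w(t_{w'}),\,1\}$ for every remaining proper descendant $w'$ of $v$, where $w$ is the parent of $w'$. 3. Sample $Y$ from the current target distribution at the last node of $X^\tau$ and output $(X^\tau,Y)$.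
   Formalization: For children drawn with replacement, D_v is left unchanged after a rejection (zeroing and renormalizing it, as written, makes the claim false); without replacement the update is as stated. Quotients 0/0 are read as 0, and the vocabulary is finite. *)

(* Defs.v *)
From HB Require Import structures.
From mathcomp Require Import all_boot all_order all_algebra.
From mathcomp Require Import all_classical all_reals all_analysis.

Set Implicit Arguments.
Unset Strict Implicit.
Unset Printing Implicit Defensive.

Import Order.TTheory GRing.Theory Num.Theory.

Local Open Scope classical_set_scope.
Local Open Scope ring_scope.

(* [M X0 [:: x_1; ...; x_i]] is the conditional distribution
   M(. | X0, x_1, ..., x_i); the prefix X0 may be of any type. *)
Definition autoregressive (R : realType) (X : finType) (Prefix : Type)
    (M : Prefix -> seq X -> X -> R) : Prop :=
  forall X0 s, (forall x, 0 <= M X0 s x) /\ \sum_x M X0 s x = 1.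

(* Ordered forests in first-child/next-sibling form: [Child a below next] is a
   node [a], the forest [below] of its children, and its later siblings [next].
   A tree rooted at X0 is given by the forest of the children of its root. *)
Inductive forest (A : Type) : Type :=
| NoChild
| Child of A & forest A & forest A.
Arguments NoChild {A}.

Fixpoint nb_nodes (A : Type) (f : forest A) : nat :=
  if f is Child _ below next then (nb_nodes below + nb_nodes next).+1 else 0.

(* [c] lists the tokens along some path of nodes that starts at the root (X0
   itself is left out, so [size c] is the depth of the last node). *)
Fixpoint is_chain (X : eqType) (f : forest X) (c : seq X) : bool :=
  match f, c with
  | _, [::] => true
  | NoChild, _ :: _ => false
  | Child t below next, x :: c' =>
      ((x == t) && is_chain below c') || is_chain next c
  end.

(* The distribution of the next child after [t] has been drawn from [D]. *)
Definition next_draft (R : realType) (X : finType) (replacement : bool)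
    (D : X -> R) (t : X) : X -> R :=
  if replacement then D else fun x => if x == t then 0 else D x / (1 - D t).

(* A policy saying which nodes of the decoding tree are expanded: [Draw a b]
   draws one more child; if its token is [t], its descendants are grown by [a t]
   and its later siblings by [b t].  So the number of children of a node may
   depend on the tokens drawn so far; a fixed tree topology is the case where
   all these functions are constant. *)
Inductive growth (X : Type) : Type :=
| Stop
| Draw of (X -> growth X) & (X -> growth X).

(* Probability that the children (with their descendants) of the last node of
   the chain [v] are [f], when the next child is drawn from [D]; [wr v] tells
   whether the children of [v] are drawn with replacement.  Drawing from an
   exhausted distribution (all tokens already removed) has probability 0 for
   every outcome, so that no random tree follows a policy which requires it. *)
Fixpoint growth_prob (R : realType) (X : finType) (Ms : seq X -> X -> R)
    (wr : seq X -> bool) (g : growth X) (v : seq X) (D : X -> R)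
    (f : forest X) : R :=
  match g, f with
  | Stop, NoChild => 1
  | Draw a b, Child t below next =>
      D t
      * growth_prob Ms wr (a t) (rcons v t) (Ms (rcons v t)) below
      * growth_prob Ms wr (b t) v (next_draft (wr v) D t) next
  | _, _ => 0
  end.

Definition decoding_tree (R : realType) (X : finType) (Ms : seq X -> X -> R)
    (wr : seq X -> bool) (d : measure_display) (Omega : measurableType d)
    (P : probability Omega R) (T : Omega -> forest X) : Prop :=
  exists g : growth X, forall t : forest X,
    measurable (T @^-1` [set t]) /\
    P (T @^-1` [set t]) = (growth_prob Ms wr g [::] (Ms [::]) t)%:E.

(* The data p(v), B_v, D_v attached to a node v.  D_v is defined, but not used,
   for nodes without children. *)
Record cell (R : realType) (X : finType) := Cell {
  rate : R;
  target : X -> R;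
  draft : X -> R
}.

Definition child_rate (R : realType) (X : finType) (v : cell R X) (t : X) : R :=
  Num.min (rate v * target v t / draft v t) 1.

(* Recompute the acceptance rates of all proper descendants of [v], whose
   remaining children are [f]. *)
Fixpoint recompute (R : realType) (X : finType) (v : cell R X)
    (f : forest (X * cell R X)) : forest (X * cell R X) :=
  match f with
  | NoChild => NoChild
  | Child (t, u) below next =>
      let u' := Cell (child_rate v t) (target u) (draft u) in
      Child (t, u') (recompute u' below) (recompute v next)
  end.

Definition root_cell (R : realType) (X : finType)
    (Ms Mb : seq X -> X -> R) : cell R X := Cell 1 (Mb [::]) (Ms [::]).

(* Initial data of the descendants of the node [v], reached by the chain [c]. *)
Fixpoint initialize (R : realType) (X : finType) (Ms Mb : seq X -> X -> R)
    (c : seq X) (v : cell R X) (f : forest X) : forest (X * cell R X) :=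
  match f with
  | NoChild => NoChild
  | Child t below next =>
      let c' := rcons c t in
      let u := Cell (child_rate v t) (Mb c') (Ms c') in
      Child (t, u) (initialize Ms Mb c' u below) (initialize Ms Mb c v next)
  end.

(* Update of the data of [v] after the rejection of a child with token [t].
   D_v is kept equal to the distribution from which the next child of v was
   drawn: the zeroing and renormalization of D_v apply to children drawn without
   replacement.  (With repeated sibling tokens, zeroing D_v at [t] would make the
   output law wrong: a later sibling may carry [t] again.) *)
Definition reject_child (R : realType) (X : finType) (replacement : bool)
    (v : cell R X) (t : X) : cell R X :=
  let r x := Num.max (rate v * target v x - draft v x) 0 in
  let S := \sum_x r x in
  Cell (S / (S + 1 - rate v)) (fun x => r x / S)
       (next_draft replacement (draft v) t).

(* Effect of one iteration on the subtree at a node: its first leaf is accepted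
   (giving the path to it and its current target distribution), or the node is
   itself the leaf and is rejected, or a proper descendant is rejected. *)
Variant outcome (R : realType) (X : finType) : Type :=
| Accepted of seq X & (X -> R)
| Rejected
| Updated of cell R X & forest (X * cell R X).
Arguments Rejected {R X}.

(* One iteration, with the uniform variate [eta], on the subtree at the last
   node [v] of the chain [c], whose remaining children are [f]. *)
Fixpoint visit (R : realType) (X : finType) (wr : seq X -> bool) (eta : R)
    (c : seq X) (v : cell R X) (f : forest (X * cell R X)) : outcome R X :=
  match f with
  | NoChild => if eta < rate v then Accepted [::] (target v) else Rejected
  | Child (t, u) below next =>
      match visit wr eta (rcons c t) u below with
      | Accepted s B => Accepted (t :: s) B
      | Rejected =>
          let v' := reject_child (wr c) v t in Updated v' (recompute v' next)
      | Updated u' below' => Updated v (Child (t, u') below' next)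
      end
  end.

(* Iterations number [k], [k + 1], ..., at most [n] of them.  If the tree becomes
   empty, the accepted chain is the root alone (tau = 0). *)
Fixpoint iterate (R : realType) (X : finType) (wr : seq X -> bool)
    (eta : nat -> R) (n k : nat) (v : cell R X)
    (f : forest (X * cell R X)) : seq X * (X -> R) :=
  if n is n'.+1 then
    match visit wr (eta k) [::] v f with
    | Accepted s B => (s, B)
    | Rejected => ([::], target v)
    | Updated v' f' => iterate wr eta n' k.+1 v' f'
    end
  else ([::], target v).

(* The accepted chain (without X0) and the current target distribution at its
   last node when the loop ends.  Each iteration either ends the loop or deletes
   one node, so the number of nodes (root included) bounds the iterations. *)
Definition traversal (R : realType) (X : finType) (Ms Mb : seq X -> X -> R)
    (wr : seq X -> bool) (T : forest X) (eta : nat -> R) : seq X * (X -> R) :=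
  let v := root_cell Ms Mb in
  iterate wr eta (nb_nodes T).+1 0 v (initialize Ms Mb [::] v T).

(* [eta 0], [eta 1], ... are uniform on (0, 1), and they are mutually independent
   and jointly independent of the random tree [T]. *)
Definition fresh_uniforms (R : realType) (X : finType) (d : measure_display)
    (Omega : measurableType d) (P : probability Omega R)
    (T : Omega -> forest X) (eta : nat -> {RV P >-> R}) : Prop :=
  (forall i (A : set R), measurable A ->
     P (eta i @^-1` A) = uniform_prob (@ltr01 R) A) /\
  (forall (t : forest X) n (A : nat -> set R), (forall i, measurable (A i)) ->
     P [set w | T w = t /\ forall i, (i < n)%N -> A i (eta i w)]
     = (P (T @^-1` [set t]) * \prod_(i < n) P (eta i @^-1` A i))%E).

(* Given the tree and the result [(c, B)] of the loop, [Y] has law [B]. *)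
Definition sampled_from (R : realType) (X : finType) (d : measure_display)
    (Omega : measurableType d) (P : probability Omega R)
    (T : Omega -> forest X) (result : Omega -> seq X * (X -> R))
    (Y : Omega -> X) : Prop :=
  (forall y, measurable (Y @^-1` [set y])) /\
  (forall t c B y,
     P [set w | [/\ T w = t, result w = (c, B) & Y w = y]]
     = (P [set w | T w = t /\ result w = (c, B)] * (B y)%:E)%E).

(* [(Z 0, Z 1, ...)], which stands for (Z_1, Z_2, ...), starts with the output
   (X_1, ..., X_tau, Y) and is continued by sampling from [Mb]. *)
Definition continuation (R : realType) (X : finType) (d : measure_display)
    (Omega : measurableType d) (P : probability Omega R)
    (Mb : seq X -> X -> R) (chain : Omega -> seq X) (Y : Omega -> X)
    (Z : nat -> Omega -> X) : Prop :=
  [/\ forall i x, measurable (Z i @^-1` [set x]),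
      forall w, mkseq (Z^~ w) (size (chain w)).+1 = rcons (chain w) (Y w)
    & forall (c z : seq X) (y : X), (size c < size z)%N ->
        P [set w | chain w = c /\ mkseq (Z^~ w) (size z).+1 = rcons z y]
        = (P [set w | chain w = c /\ mkseq (Z^~ w) (size z) = z]
           * (Mb z y)%:E)%E].

(* Main.v *)
Require Import Defs.
From HB Require Import structures.
From mathcomp Require Import all_boot all_order all_algebra.
From mathcomp Require Import all_classical all_reals all_analysis.
From mathcomp Require Import measurable_realfun ring lra zify.

Set Implicit Arguments.
Unset Strict Implicit.
Unset Printing Implicit Defensive.

Import Order.TTheory GRing.Theory Num.Theory.

Local Open Scope classical_set_scope.
Local Open Scope ring_scope.

(* The subtree at a node with acceptance rate p and target B, whose children are
   drawn from D, is accepted in such a way that the continued output has the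
   sub-probability p B, and is rejected with probability 1 - p.  By induction on
   the tree: its first child, with token t ~ D, is accepted with probability
   min(p B(t) / D(t), 1), which contributes min(p B, D); it is rejected with
   total probability S + 1 - p, where S = sum [p B - D]_+, and then the later
   siblings contribute (S + 1 - p) p' B' = [p B - D]_+.  The two add up to p B.

   Only the inequality "<=" is proved this way, since a growth policy may draw
   from an exhausted distribution and its trees may have total mass below 1.  At
   the root, where p = 1, this bounds the law of (Z_1, ..., Z_n) by a probability,
   and two probabilities on a finite set of which one bounds the other are equal. *)

(** * The iterations as a recursion on the tree *)

Section Simulation.
Variables (R : realType) (X : finType) (Ms Mb : seq X -> X -> R).
Variables (wr : seq X -> bool) (u : R -> R).
Implicit Types (c s : seq X) (v : cell R X) (f : forest (X * cell R X)).
Implicit Types (phi : seq X * (X -> R) -> R) (rho : (X -> R) -> R).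

Fixpoint strip f : forest X :=
  match f with
  | NoChild => NoChild
  | Child (t, _) below next => Child t (strip below) (strip next)
  end.

Definition child_cell c v t : cell R X :=
  Cell (child_rate v t) (Mb (rcons c t)) (Ms (rcons c t)).

(* Expected payoff of the processing of the subtree at the last node [v] of [c]:
   [phi] is paid on acceptance and [rho] when [v] itself is rejected; [u q] is
   the probability of [eta < q]. *)
Fixpoint value c v (f : forest X) phi rho : R :=
  match f with
  | NoChild =>
      u (rate v) * phi ([::], target v) + (1 - u (rate v)) * rho (target v)
  | Child t below next =>
      value (rcons c t) (child_cell c v t) below
        (fun r => phi (t :: r.1, r.2))
        (fun=> value c (reject_child (wr c) v t) next phi rho)
  end.

(* The same from an intermediate state, in which the leftmost branch has been
   partially processed. *)
Fixpoint state_value c v f phi rho : R :=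
  match f with
  | NoChild =>
      u (rate v) * phi ([::], target v) + (1 - u (rate v)) * rho (target v)
  | Child (t, w) below next =>
      state_value (rcons c t) w below
        (fun r => phi (t :: r.1, r.2))
        (fun=> value c (reject_child (wr c) v t) (strip next) phi rho)
  end.

(** The invariant of the loop: rejections alter only cells on the leftmost branch, and everything
    hanging to its right is still in its initial state relative to the current cell of its
    parent. *)
Fixpoint reachable_state c v f : Prop :=
  match f with
  | NoChild => True
  | Child (t, w) below next =>
      reachable_state (rcons c t) w below
      /\ next = initialize Ms Mb c v (strip next)
  end.

Fixpoint leaf_rate v f : R :=
  if f is Child (_, w) below _ then leaf_rate w below else rate v.

Lemma initializeK c v (f : forest X) : strip (initialize Ms Mb c v f) = f.
Proof. by elim: f c v => //= t b IHb n IHn c v; rewrite IHb IHn. Qed.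

(** Recomputation changes rates only, and the initial targets and drafts below a node do not depend
    on its cell. Hence after a rejection the later siblings are again in an initial state, now
    relative to the updated parent. *)
Lemma recompute_initialize c v v' (f : forest X) :
  recompute v' (initialize Ms Mb c v f) = initialize Ms Mb c v' f.
Proof. by elim: f c v v' => //= t b IHb n IHn c v v'; rewrite IHb IHn. Qed.

Lemma reachable_initialize c v (f : forest X) :
  reachable_state c v (initialize Ms Mb c v f).
Proof.
elim: f c v => //= t b IHb n IHn c v.
by split; [exact: IHb | rewrite initializeK].
Qed.

Lemma state_value_initialize c v (f : forest X) phi rho :
  state_value c v (initialize Ms Mb c v f) phi rho = value c v f phi rho.
Proof.
elim: f c v phi rho => //= t b IHb n _ c v phi rho.
by rewrite IHb initializeK.
Qed.

Lemma nb_nodes_initialize c v (f : forest X) :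
  nb_nodes (initialize Ms Mb c v f) = nb_nodes f.
Proof. by elim: f c v => //= t b IHb n IHn c v; rewrite IHb IHn. Qed.

(** The variate matters only through its comparison with the rate of the first leaf, so an iteration
    has two outcomes, [r] on acceptance and [o] otherwise, and the expected payoff splits
    accordingly. A continuing loop keeps the invariant and loses one node. *)
Lemma visit_step c v f phi rho : reachable_state c v f ->
  exists r o,
    (forall eta : R, visit wr eta c v f =
       if eta < leaf_rate v f then Accepted r.1 r.2 else o) /\
    match o with
    | Accepted _ _ => False
    | Rejected => state_value c v f phi rho =
        u (leaf_rate v f) * phi r + (1 - u (leaf_rate v f)) * rho (target v)
    | Updated v' f' =>
        [/\ reachable_state c v' f', nb_nodes f = (nb_nodes f').+1
          & state_value c v f phi rho =
            u (leaf_rate v f) * phi r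
            + (1 - u (leaf_rate v f)) * state_value c v' f' phi rho]
    end.
Proof.
elim: f c v phi rho => [|[t w] b IHb n _] c v phi rho /=.
  by move=> _; exists ([::], target v), Rejected.
case=> wfb nE.
have [[s B] [ o [oE]]] := IHb (rcons c t) w (fun r => phi (t :: r.1, r.2))
  (fun=> value c (reject_child (wr c) v t) (strip n) phi rho) wfb.
case: o oE => // [|w' b'] oE.
- move=> vE; exists (t :: s, B).
  exists (Updated (reject_child (wr c) v t)
    (initialize Ms Mb c (reject_child (wr c) v t) (strip n))).
  (* Only a leaf can be rejected: visiting a node with children gives [Accepted] or [Updated]. The
     variate [leaf_rate w b] is not below itself, so it selects the outcome [Rejected]. *)
  have bE : b = NoChild.
    have := oE (leaf_rate w b); rewrite ltxx.
    by case: (b) => [//|[? ?] ? ?] /=; case: visit.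
  split=> [eta|]; first by rewrite oE nE recompute_initialize initializeK; case: ifP.
  split; first exact: reachable_initialize.
  + by rewrite nb_nodes_initialize bE /= add0n {1}nE nb_nodes_initialize.
  + by rewrite vE state_value_initialize.
- case=> wfb' nbE vE; exists (t :: s, B), (Updated v (Child (t, w') b' n)).
  split=> [eta|/=]; first by rewrite oE; case: ifP.
  by rewrite nbE addSn.
Qed.

Definition branch (next_law : cell R X -> forest (X * cell R X) ->
    seq (R * (seq X * (X -> R)))) v (a : R) (o : outcome R X) :=
  match o with
  | Accepted s B => [:: (a, (s, B))]
  | Rejected => [:: (a, ([::], target v))]
  | Updated v' f' => [seq (a * p.1, p.2) | p <- next_law v' f']
  end.

(* The law of the result of at most [n] iterations, as a list of weighted
   results in which the same result may occur several times. *)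
Fixpoint law (n : nat) v f : seq (R * (seq X * (X -> R))) :=
  if n is n'.+1 then
    let q := leaf_rate v f in
    branch (law n') v (u q) (visit wr (q - 1) [::] v f)
    ++ branch (law n') v (1 - u q) (visit wr q [::] v f)
  else [:: (1, ([::], target v))].

(** Each iteration deletes a node, so the bound on [n] leaves enough iterations. Rejecting the root
    yields the empty chain, whence the choice of the rejection payoff. *)
Lemma law_value n v f phi : reachable_state [::] v f -> (nb_nodes f < n)%N ->
  \sum_(p <- law n v f) p.1 * phi p.2 =
  state_value [::] v f phi (fun B => phi ([::], B)).
Proof.
elim: n v f => // n IHn v f wf fn; rewrite [law _ _ _]/=.
have [r [ o [oE]]] := visit_step phi (fun B => phi ([::], B)) wf.
rewrite !oE ltxx gtrBl ltr01 big_cat big_seq1 /= -surjective_pairing.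
case: o {oE} => // [->|v' f' [wf' ff' ->]]; first by rewrite big_seq1.
congr (_ + _); rewrite big_map -IHn //; last by lia.
by rewrite big_distrr; apply: eq_bigr => i _; rewrite /= mulrA.
Qed.

Lemma sum_branch next_law v a o (Q : pred (seq X * (X -> R))) :
  \sum_(p <- branch next_law v a o | Q p.2) p.1 =
  a * \sum_(p <- branch next_law v 1 o | Q p.2) p.1.
Proof.
case: o => [s B||v' f'] /=; rewrite ?big_map; last first.
  by rewrite mulr_sumr; apply: eq_bigr => p _; rewrite mul1r.
all: by rewrite !big_cons !big_nil /=; case: ifP; rewrite ?addr0 ?mulr1 ?mulr0.
Qed.

(** With q the rate of the first leaf, q - 1 and q represent all variates below q and all the
    others; [law] evaluates [visit] at these two points. *)
Lemma visitE (eta : R) c v f :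
  visit wr eta c v f =
  visit wr (if eta < leaf_rate v f then leaf_rate v f - 1 else leaf_rate v f)
    c v f.
Proof.
elim: f eta c v => [|[t w] b IHb n _] eta c v /=; last by rewrite IHb.
by case: ltP => _; rewrite ?gtrBl ?ltr01 ?ltxx.
Qed.

(** Whatever the variates are, a given tree leads to finitely many results, so sums over results are
    finite. *)
Lemma iterate_in_law (eta : nat -> R) n k v f :
  iterate wr eta n k v f \in [seq p.2 | p <- law n v f].
Proof.
elim: n k v f => [|n IHn] k v f /=; first by rewrite inE.
rewrite visitE map_cat mem_cat; case: ltP => _; apply/orP; [left|right].
all: case: visit => [s B||v' f'] /=; rewrite ?inE // -map_comp; exact: IHn.
Qed.

End Simulation.

(** * The accepted chain lies in the tree *)

Lemma subset_chain (X : eqType) (t : X) (b b' n n' : forest X) c :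
  (forall c, is_chain b c -> is_chain b' c) ->
  (forall c, is_chain n c -> is_chain n' c) ->
  is_chain (Child t b n) c -> is_chain (Child t b' n') c.
Proof.
move=> bb nn; case: c => //= x c /orP[/andP[-> /bb ->] //|/nn ->].
by rewrite orbT.
Qed.

Lemma is_chain_nil (X : eqType) (f : forest X) : is_chain f [::].
Proof. by case: f. Qed.

Lemma strip_recompute (R : realType) (X : finType) (v : cell R X) f :
  strip (recompute v f) = strip f.
Proof.
elim: f v => //= -[t w] b IHb n IHn v /=.
by rewrite IHb IHn.
Qed.

(** An iteration deletes nodes and changes cells, so it creates no new chain. *)
Lemma visit_chain (R : realType) (X : finType) wr (eta : R) c
    (v : cell R X) f :
  match visit wr eta c v f return Prop with
  | Accepted s _ => is_chain (strip f) s
  | Rejected => True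
  | Updated _ f' => forall s, is_chain (strip f') s -> is_chain (strip f) s
  end.
Proof.
elim: f c v => [|[t w] b IHb n _] c v /=; first by case: ifP.
have := IHb (rcons c t) w; case: visit => [s B|_|w' b'] /=.
- by rewrite eqxx => ->.
- by move=> [|x s] //=; rewrite strip_recompute => ->; rewrite orbT.
- by move=> bb s; apply: subset_chain.
Qed.

Lemma iterate_chain (R : realType) (X : finType) wr (eta : nat -> R) n k
    (v : cell R X) f :
  is_chain (strip f) (iterate wr eta n k v f).1.
Proof.
elim: n k v f => [|n IHn] k v f /=; first exact: is_chain_nil.
have := visit_chain wr (eta k) [::] v f.
case: visit => [//||v' f' sub] /=; first by rewrite is_chain_nil.
exact/sub/IHn.
Qed.

(** * Mean over the random tree *)

Section Expectation.
Variables (R : realType) (X : finType) (Ms Mb : seq X -> X -> R).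
Variables (wr : seq X -> bool) (u : R -> R).
Hypothesis Ms0 : forall c x, 0 <= Ms c x.
Hypothesis Ms1 : forall c, \sum_x Ms c x = 1.
Hypothesis Mb0 : forall c x, 0 <= Mb c x.
Hypothesis Mb1 : forall c, \sum_x Mb c x = 1.
Hypothesis uE : forall q, 0 <= q <= 1 -> u q = q.
Implicit Types (c s z : seq X) (v : cell R X) (D : X -> R).

(* The null case is the exhausted distribution of draws without replacement. *)
Definition draft_law D : Prop :=
  (forall x, 0 <= D x) /\ (\sum_x D x = 1 \/ forall x, D x = 0).

Lemma draft_law_le1 D t : draft_law D -> D t <= 1.
Proof.
case=> D0 [<-|->]; last exact: ler01.
by rewrite (bigD1 t) //= lerDl sumr_ge0.
Qed.

Lemma draft_law_next b D t : draft_law D -> draft_law (next_draft b D t).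
Proof.
move=> hD; have Dt1 := draft_law_le1 t hD; case: hD => D0 DE.
case: b => //=; rewrite /next_draft; split=> [x|].
  by case: ifP => // _; rewrite divr_ge0 ?subr_ge0.
(* If [D t] is 1, dividing by 1 - [D t] = 0 returns 0, which produces the null function of an
   exhausted draft. *)
have [Dt|Dt] := eqVneq (D t) 1.
  by right=> x; case: ifP => //; rewrite Dt subrr invr0 mulr0.
case: DE => [D1|Dz]; last by right=> x; rewrite Dz mul0r if_same.
left; rewrite (bigD1 t) //= eqxx add0r.
rewrite (eq_bigr (fun x => D x / (1 - D t))) => [|x /negPf-> //].
have -> : \sum_(x | x != t) D x / (1 - D t) = (1 - D t) / (1 - D t).
  rewrite -mulr_suml; congr (_ / _).
  by move: D1; rewrite (bigD1 t) //= => <-; rewrite addrAC subrr add0r.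
by rewrite divff // subr_eq0 eq_sym.
Qed.

(** The later siblings are averaged outside the descendants of the first child, so that their value
    is a constant in the inner mean. *)
Fixpoint mean (g : growth X) c D (F : forest X -> R) : R :=
  match g with
  | Stop => F NoChild
  | Draw a b =>
      \sum_t D t * mean (b t) c (next_draft (wr c) D t) (fun next =>
        mean (a t) (rcons c t) (Ms (rcons c t)) (fun below =>
          F (Child t below next)))
  end.

Lemma draft_law_Ms c : draft_law (Ms c).
Proof. by split; [exact: Ms0 | left; exact: Ms1]. Qed.
Hint Resolve draft_law_Ms : core.

Lemma ler_mean g c D F G : draft_law D ->
  (forall f, F f <= G f) -> mean g c D F <= mean g c D G.
Proof.
elim: g c D F G => [|a IHa b IHb] c D F G hD FG //=.
apply: ler_sum => t _; rewrite ler_wpM2l ?hD.1 //.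
apply: IHb => [|next]; first exact: draft_law_next.
by apply: IHa.
Qed.

(** The constant [k] is weighted by the total mass of the random forest, which exhausted drafts may
    bring below 1. *)
Lemma mean_affine g c D F k l :
  mean g c D (fun f => k + l * F f) = k * mean g c D (fun=> 1) + l * mean g c D F.
Proof.
elim: g c D F k l => [|a IHa b IHb] c D F k l /=; first by rewrite mulr1.
rewrite !mulr_sumr -big_split; apply: eq_bigr => t _ /=.
under [in LHS]eq_fun => next do rewrite IHa.
set N := mean (a t) _ _ _.
rewrite IHb.
have -> : (fun=> N) = (fun f : forest X => 0 + N * (fun=> 1) f) :> (forest X -> R).
  by apply/funext => f; rewrite add0r mulr1.
rewrite (IHb t c _ (fun=> 1) 0 N); ring.
Qed.

Lemma mean1_le1 g c D : draft_law D -> mean g c D (fun=> 1) <= 1.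
Proof.
elim: g c D => [|a IHa b IHb] c D hD //=.
have : \sum_t D t <= 1 by case: hD => _ [->//|Dz]; rewrite big1 ?ler01.
apply: le_trans; apply: ler_sum => t _.
rewrite ler_piMr ?hD.1 //; have hD' := draft_law_next (wr c) t hD.
apply: le_trans (IHb t c _ hD'); apply: ler_mean => // _; exact: IHa.
Qed.

Fixpoint path_prob c z : R :=
  if z is x :: z' then Mb c x * path_prob (rcons c x) z' else 1.

(** An empty [z] constrains nothing, so every token matches it. *)
Definition head_match z t : R := if z is x :: _ then (x == t)%:R else 1.

(* Probability that the sequence following the chain [c] extends [z], given that
   the accepted chain is [c ++ s] and that the next token has law [B]. *)
Fixpoint pay c z s (B : X -> R) : R :=
  if s is t :: s' then head_match z t * pay (rcons c t) (behead z) s' B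
  else if z is x :: z' then B x * path_prob (rcons c x) z' else 1.

(** The conditional probability, under the target model, that the continuation of [c] extends [z]
    when its next token is [t]. *)
Definition child_weight c z t : R := head_match z t * path_prob (rcons c t) (behead z).

Lemma path_prob_ge0 c z : 0 <= path_prob c z.
Proof. by elim: z c => //= x z IHz c; rewrite mulr_ge0. Qed.

Lemma head_match_ge0 z t : 0 <= head_match z t.
Proof. by case: z => //= x z; rewrite ler0n. Qed.

Lemma child_weight_ge0 c z t : 0 <= child_weight c z t.
Proof. by rewrite mulr_ge0 ?head_match_ge0 ?path_prob_ge0. Qed.

Lemma pay_ge0 c z s B : (forall x, 0 <= B x) -> 0 <= pay c z s B.
Proof.
move=> B0; elim: s c z => [|t s IHs] c z /=.
  by case: z => // x z; rewrite mulr_ge0 ?path_prob_ge0.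
by rewrite mulr_ge0 ?head_match_ge0.
Qed.

Lemma sum_target_weight (B : X -> R) c x z :
  \sum_t B t * child_weight c (x :: z) t = B x * path_prob (rcons c x) z.
Proof.
rewrite (bigD1 x) //= /child_weight /= eqxx mul1r big1 ?addr0 // => t.
by rewrite eq_sym => /negPf ->; rewrite mul0r mulr0.
Qed.

Lemma sum_Mb_weight c z : \sum_t Mb c t * child_weight c z t = path_prob c z.
Proof.
case: z => [|x z]; last by rewrite sum_target_weight.
by under eq_bigr do rewrite /child_weight mul1r mulr1; rewrite Mb1.
Qed.

(** The equation says that the target has mass 1 unless the rate is 0. The exception occurs when S =
    0: division by 0 then makes both the new target and the new rate vanish. *)
Definition cell_law v : Prop :=
  [/\ 0 <= rate v <= 1, forall x, 0 <= target v x, \sum_x target v x <= 1,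
      rate v * \sum_x target v x = rate v & draft_law (draft v)].

Lemma cell_law_child c v t : cell_law v -> cell_law (child_cell Ms Mb c v t).
Proof.
case=> /andP[p0 p1] B0 _ _ hD; split => //=; rewrite ?Mb1 ?mulr1 //.
by rewrite le_min ler01 !andbT ge_min lexx orbT !mulr_ge0 ?invr_ge0 ?hD.1.
Qed.

Definition residual v x : R := Num.max (rate v * target v x - draft v x) 0.

Lemma residual_ge0 v x : 0 <= residual v x.
Proof. by rewrite le_max lexx orbT. Qed.

Lemma sum_residual_ge0 v : 0 <= \sum_x residual v x.
Proof. by apply: sumr_ge0 => x _; exact: residual_ge0. Qed.

Lemma cell_law_reject c v t : cell_law v -> cell_law (reject_child (wr c) v t).
Proof.
case=> /andP[p0 p1] B0 B1 pB hD; have S0 := sum_residual_ge0 v.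
have Q0 : 0 <= \sum_x residual v x + 1 - rate v by lra.
split=> /=; last exact: draft_law_next.
- rewrite divr_ge0 //=.
  have [Q|Q] := eqVneq (\sum_x residual v x + 1 - rate v) 0.
    by rewrite /residual in Q; rewrite Q invr0 mulr0 ler01.
  rewrite ler_pdivrMr ?lt_def ?Q ?Q0 // mul1r.
  change (\sum_x residual v x <= \sum_x residual v x + 1 - rate v); lra.
- by move=> x; rewrite divr_ge0 ?residual_ge0.
- rewrite -mulr_suml; have [->|S] := eqVneq (\sum_x residual v x) 0.
    by rewrite mul0r ler01.
  by rewrite divff.
- rewrite -mulr_suml -/(residual v).
  have [->|S] := eqVneq (\sum_x residual v x) 0; first by rewrite !mul0r.
  by rewrite divff ?mulr1.
Qed.

Lemma value_ge0 c v (f : forest X) phi rho : cell_law v ->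
  (forall s B, (forall x, 0 <= B x) -> 0 <= phi (s, B)) ->
  (forall B, (forall x, 0 <= B x) -> 0 <= rho B) ->
  0 <= value Ms Mb wr u c v f phi rho.
Proof.
elim: f c v phi rho => [|t b IHb n IHn] c v phi rho hv phi0 rho0 /=.
  case: hv => hp B0 _ _ _; rewrite uE //; case/andP: hp => p0 p1.
  by rewrite addr_ge0 // mulr_ge0 ?subr_ge0 ?phi0 ?rho0.
apply: IHb; first exact: cell_law_child.
  by move=> s B B0; exact: phi0.
by move=> _ _; apply: IHn => //; exact: cell_law_reject.
Qed.

Lemma accept_child v t : cell_law v ->
  draft v t * child_rate v t = Num.min (rate v * target v t) (draft v t).
Proof.
case=> /andP[p0 p1] B0 _ _ [D0 _]; rewrite /child_rate.
have [->|Dt] := eqVneq (draft v t) 0.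
  by rewrite mul0r min_r ?mulr_ge0.
by rewrite minr_pMr // mulr1 mulrC divfK.
Qed.

(** This is min(a, b) = a - [a - b]_+ with a = p B(t) and b = D(t). Summed over [t] it yields the
    rejection probability S + 1 - p when the draft has mass 1. *)
Lemma reject_child_mass v t : cell_law v ->
  draft v t * (1 - child_rate v t) =
  draft v t - rate v * target v t + residual v t.
Proof.
move=> hv; rewrite mulrBr mulr1 accept_child // /residual.
by case: leP => ?; case: leP => ?; lra.
Qed.

(* The core of the argument: acceptance through the first child contributes
   [min (p B) D], the later siblings contribute the residual [[p B - D]_+]. *)
Lemma mean_value_le g c z v alpha rho K :
  cell_law v -> 0 <= alpha -> 0 <= K ->
  (forall B, (forall x, 0 <= B x) -> 0 <= rho B) ->
  (forall B, (forall x, 0 <= B x) -> \sum_x B x <= 1 -> rho B <= K) ->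
  mean g c (draft v) (fun f =>
    value Ms Mb wr u c v f (fun r => alpha * pay c z r.1 r.2) rho)
  <= alpha * (rate v * \sum_t target v t * child_weight c z t)
     + (1 - rate v) * K.
Proof.
elim: g c z v alpha rho K => [|a IHa b IHb] c z v alpha rho K hv al0 K0 rho0 rhoK.
  case: (hv) => /andP[p0 p1] B0 B1 pB hD; rewrite /= uE ?p0 ?p1 //.
  apply: lerD; last by rewrite ler_wpM2l ?subr_ge0 ?rhoK.
  rewrite mulrCA ler_wpM2l //.
  (* For empty [z] the payoff is 1 and the sum is the mass of the target, which is 1 unless the rate
     vanishes. *)
  case: z => [|x z]; last by rewrite sum_target_weight.
  under eq_bigr do rewrite /child_weight mul1r mulr1.
  by rewrite pB mulr1.
case: (hv) => /andP[p0 p1] B0 B1 pB hD /=.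
pose v' t := reject_child (wr c) v t.
pose S := \sum_x residual v x.
have S0 : 0 <= S := sum_residual_ge0 v.
pose p' := S / (S + 1 - rate v).
(* The bound that the induction hypothesis gives for the later siblings. It does not depend on the
   rejected token, because the new rate and target do not. *)
pose L := alpha * (p' * \sum_t residual v t / S * child_weight c z t) + (1 - p') * K.
have hv' t : cell_law (v' t) by exact: cell_law_reject.
have hu t : cell_law (child_cell Ms Mb c v t) by exact: cell_law_child.
have term t : mean (b t) c (next_draft (wr c) (draft v) t) (fun next =>
      mean (a t) (rcons c t) (Ms (rcons c t)) (fun below =>
        value Ms Mb wr u (rcons c t) (child_cell Ms Mb c v t) below
          (fun r => alpha * pay c z (t :: r.1) r.2)
          (fun=> value Ms Mb wr u c (v' t) next
             (fun r => alpha * pay c z r.1 r.2) rho)))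
    <= child_rate v t * alpha * child_weight c z t + (1 - child_rate v t) * L.
  have q01 : 0 <= child_rate v t <= 1 by case: (hu t).
  case/andP: q01 => q0 q1.
  have hD' := draft_law_next (wr c) t hD.
  apply: (@le_trans _ _ (mean (b t) c (next_draft (wr c) (draft v) t)
    (fun next => child_rate v t * alpha * child_weight c z t
       + (1 - child_rate v t) * value Ms Mb wr u c (v' t) next
             (fun r => alpha * pay c z r.1 r.2) rho))).
    apply: ler_mean => // next.
    have V0 : 0 <= value Ms Mb wr u c (v' t) next
             (fun r => alpha * pay c z r.1 r.2) rho.
      by apply: value_ge0 => // s B HB; rewrite mulr_ge0 ?pay_ge0.
    (* For the subtree of the first child, the value of the later siblings is a constant rejection
       payoff, hence also its own bound [K]. *)
    have := IHa t (rcons c t) (behead z) (child_cell Ms Mb c v t)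
      (alpha * head_match z t) (fun=> value Ms Mb wr u c (v' t) next
             (fun r => alpha * pay c z r.1 r.2) rho) _ (hu t)
      (mulr_ge0 al0 (head_match_ge0 z t)) V0 (fun _ _ => V0) (fun _ _ _ => lexx _).
    rewrite /= sum_Mb_weight.
    under [X in mean _ _ _ X <= _ -> _]eq_fun => below.
      under [X in value _ _ _ _ _ _ _ X]eq_fun => r do rewrite -mulrA.
      over.
    move=> H; apply: le_trans H _; rewrite /child_weight.
    by rewrite le_eqVlt; apply/orP; left; apply/eqP; ring.
  (* The constant term is multiplied by a total mass of at most 1, so only an inequality
     survives. *)
  rewrite mean_affine; apply: lerD.
    by rewrite ler_piMr ?mean1_le1 // mulr_ge0 ?child_weight_ge0 ?mulr_ge0.
  by rewrite ler_wpM2l ?subr_ge0 //; exact: (IHb t c z (v' t)).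
apply: (@le_trans _ _ (\sum_t (draft v t) *
  (child_rate v t * alpha * child_weight c z t + (1 - child_rate v t) * L))).
  by apply: ler_sum => t _; rewrite ler_wpM2l ?hD.1.
(* With an exhausted draft the mean is 0, below the nonnegative bound. *)
case: (hD) => D0 [D1|Dz]; last first.
  rewrite big1 => [|t _]; last by rewrite Dz mul0r.
  rewrite addr_ge0 ?mulr_ge0 ?subr_ge0 // sumr_ge0 // => t _.
  by rewrite mulr_ge0 ?child_weight_ge0.
have QL : (S + 1 - rate v) * L
    = alpha * (\sum_t residual v t * child_weight c z t) + (1 - rate v) * K.
  (* As S >= 0 and p <= 1, a zero rejection probability forces S = 0 and p = 1, and both sides
     vanish. *)
  have [Q|Q] := eqVneq (S + 1 - rate v) 0.
    have Sz : S = 0 by lra.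
    have -> : rate v = 1 by lra.
    rewrite Sz !(addr0, add0r, subrr, mul0r) big1 ?mulr0 // => t _.
    by have /psumr_eq0P -> := Sz; rewrite ?mul0r // => i _; exact: residual_ge0.
  have Qp : (S + 1 - rate v) * p' = S by rewrite mulrC divfK.
  rewrite /L; set W := \sum_t _ / S * _.
  have -> : (S + 1 - rate v) * (alpha * (p' * W) + (1 - p') * K) =
      alpha * (((S + 1 - rate v) * p') * W)
      + (S + 1 - rate v - (S + 1 - rate v) * p') * K by ring.
  rewrite Qp /W; congr (alpha * _ + _ * _); last by ring.
  rewrite mulr_sumr; apply: eq_bigr => t _.
  have [Sz|Sn] := eqVneq S 0; last by field.
  have /psumr_eq0P -> := Sz; rewrite ?mul0r ?mulr0 // => i _; exact: residual_ge0.
have massQ : \sum_t draft v t * (1 - child_rate v t) = S + 1 - rate v.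
  under eq_bigr do rewrite reject_child_mass //.
  rewrite big_split sumrB D1 -mulr_sumr pB /= -/S; lra.
rewrite (eq_bigr (fun t => alpha * (Num.min (rate v * target v t) (draft v t)
    * child_weight c z t) + draft v t * (1 - child_rate v t) * L)); last first.
  by move=> t _; rewrite -accept_child //; ring.
rewrite big_split -mulr_suml massQ QL -mulr_sumr /= addrA -mulrDr -big_split.
rewrite le_eqVlt; apply/orP; left; apply/eqP; congr (alpha * _ + _).
rewrite mulr_sumr; apply: eq_bigr => t _; rewrite /= -mulrDl mulrA.
by congr (_ * _); rewrite /residual; case: leP => ?; case: leP => ?; lra.
Qed.

End Expectation.

(** * Countability of the type of forests *)

Section ForestCountable.
Variable X : countType.

Fixpoint forest_encode (f : forest X) : GenTree.tree X :=
  match f with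
  | NoChild => GenTree.Node 0 [::]
  | Child t below next =>
      GenTree.Node 1 [:: GenTree.Leaf t; forest_encode below; forest_encode next]
  end.

Fixpoint forest_decode (g : GenTree.tree X) : option (forest X) :=
  match g with
  | GenTree.Node 0 [::] => Some NoChild
  | GenTree.Node 1 [:: GenTree.Leaf t; below; next] =>
      if (forest_decode below, forest_decode next) is (Some b, Some n)
      then Some (Child t b n) else None
  | _ => None
  end.

Lemma forest_encodeK : pcancel forest_encode forest_decode.
Proof. by elim=> //= t b -> n ->. Qed.

HB.instance Definition _ := Equality.copy (forest X) (pcan_type forest_encodeK).
HB.instance Definition _ := Choice.copy (forest X) (pcan_type forest_encodeK).
HB.instance Definition _ :=
  Countable.copy (forest X) (pcan_type forest_encodeK).
End ForestCountable.

(** * Finite support of the law of the random tree *)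

Section Support.
Variables (R : realType) (X : finType) (Ms : seq X -> X -> R).
Variable wr : seq X -> bool.

(** Pairs list the later siblings before the descendants, in the order of summation of [mean]. *)
Fixpoint growth_support (g : growth X) : seq (forest X) :=
  match g with
  | Stop => [:: NoChild]
  | Draw a b =>
      [seq Child t p.2 p.1 | t <- enum X,
         p <- [seq (next, below) | next <- growth_support (b t), below <- growth_support (a t)]]
  end.

Lemma growth_support_uniq g : uniq (growth_support g).
Proof.
elim: g => //= a IHa b IHb; apply: allpairs_uniq_dep.
- exact: enum_uniq.
- by move=> t _; apply: allpairs_uniq => // -[? ?] [? ?].
- by move=> [t [n f]] [t' [n' f']] _ _ /= [-> -> ->].
Qed.

Lemma growth_prob_support g c D f :
  f \notin growth_support g -> growth_prob Ms wr g c D f = 0.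
Proof.
apply: contraNeq; elim: g c D f => [|a IHa b IHb] c D [|t below next] //=;
  rewrite ?eqxx //.
rewrite !mulf_eq0 !negb_or => /andP[/andP[_ /IHa fa] /IHb fb].
apply/allpairsPdep; exists t, (next, below); split=> //.
  by rewrite mem_enum.
by apply/allpairsP; exists (next, below).
Qed.

Lemma sum_support g c D (F : forest X -> R) :
  \sum_(f <- growth_support g) growth_prob Ms wr g c D f * F f = mean Ms wr g c D F.
Proof.
elim: g c D F => [|a IHa b IHb] c D F /=; first by rewrite big_seq1 mul1r.
rewrite big_flatten big_map big_enum; apply: eq_bigr => t _ /=.
rewrite big_map big_allpairs -IHb mulr_sumr; apply: eq_bigr => n _ /=.
rewrite -IHa !mulr_sumr; apply: eq_bigr => f _ /=; ring.
Qed.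
End Support.

Lemma sum_fibers (V : nmodType) (I J : eqType) (s : seq J) (f : J -> I)
    (S : seq I) (Q : pred J) (F : J -> V) :
  uniq S -> (forall j, j \in s -> Q j -> f j \in S) ->
  \sum_(i <- S) \sum_(j <- s | Q j && (f j == i)) F j = \sum_(j <- s | Q j) F j.
Proof.
move=> uS sS; rewrite (exchange_big_dep Q) => [|i j _ /andP[] //] /=.
rewrite big_seq_cond [RHS]big_seq_cond; apply: eq_bigr => j /andP[js Qj].
under eq_bigl do rewrite Qj.
rewrite big_mkcond (bigD1_seq (f j)) ?sS //= eqxx big1 ?addr0 // => i.
by rewrite eq_sym => /negPf ->.
Qed.

(** * Law of the output *)

Section Partition.
Context (R : realType) (d : measure_display) (Omega : measurableType d).
Variable P : probability Omega R.

Lemma finite_partition (I : eqType) (S : seq I) (k : Omega -> I)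
    (E : set Omega) : uniq S -> (forall w, E w -> k w \in S) ->
  (forall i, i \in S -> measurable (E `&` [set w | k w = i])) ->
  measurable E /\ P E = (\sum_(i <- S) P (E `&` [set w | k w = i]))%E.
Proof.
elim: S E => [|i S IHS] E /=.
  move=> _ ES _; have -> : E = set0 by apply/seteqP; split=> // w /ES.
  by rewrite big_nil measure0.
case/andP=> iS uS ES mE; pose E' := E `&` [set w | k w <> i].
have E'E j : j \in S -> E' `&` [set w | k w = j] = E `&` [set w | k w = j].
  move=> jS; apply/seteqP; split=> w /=; first by case=> -[].
  by case=> Ew kj; split=> //; split=> //= ki; move: iS; rewrite -ki kj jS.
have [|j jS|mE' PE'] := IHS E' uS.
- move=> w [Ew /= ki]; have := ES _ Ew; rewrite in_cons => /orP[/eqP|//].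
  by move/ki.
- by rewrite E'E //; apply: mE; rewrite inE jS orbT.
have mEi : measurable (E `&` [set w | k w = i]) by apply: mE; rewrite inE eqxx.
have EE : E = (E `&` [set w | k w = i]) `|` E'.
  apply/seteqP; split=> w /=; last by case=> -[].
  by move=> Ew; case: (eqVneq (k w) i) => [|/eqP]; [left|right].
split; first by rewrite EE; exact: measurableU.
rewrite [in LHS]EE measureU // ?big_cons.
  by congr (_ + _)%E; apply: (etrans PE'); apply: eq_big_seq => j jS; rewrite E'E.
by apply/seteqP; split=> w // -[[_ /= ki] [_ /= /(_ ki)]].
Qed.

(** Outside [S] there are countably many pieces, all null, so their union is negligible; the rest is
    a finite partition. *)
Lemma countable_partition (I : countType) (S : seq I) (k : Omega -> I)
    (E : set Omega) : uniq S ->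
  (forall i, measurable (E `&` [set w | k w = i])) ->
  (forall i, i \notin S -> P (E `&` [set w | k w = i]) = 0%E) ->
  measurable E /\ P E = (\sum_(i <- S) P (E `&` [set w | k w = i]))%E.
Proof.
move=> uS mE nS; pose E1 := E `&` [set w | k w \in S].
have E1E i : i \in S -> E1 `&` [set w | k w = i] = E `&` [set w | k w = i].
  move=> iS; apply/seteqP; split=> w /=; first by case=> -[].
  by case=> Ew ki; split=> //; split=> //=; rewrite ki.
have [|i iS|mE1 PE1] := @finite_partition I S k E1 uS.
- by move=> w [].
- by rewrite E1E.
pose F n := if unpickle n is Some i then
  if i \in S then set0 else E `&` [set w | k w = i] else set0.
have FE : \bigcup_n F n = E `&` [set w | k w \notin S].
  apply/seteqP; split=> w /=.
    case=> n _; rewrite /F; case: unpickle => // i.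
    by case: ifP => [_ []|iS [Ew /= ki]]; rewrite ki iS.
  by case=> Ew /negPf wS; exists (pickle (k w)); rewrite // /F pickleK wS.
have mF n : measurable (F n) by rewrite /F; case: unpickle => // i; case: ifP.
have F0 n : P (F n) = 0%E.
  rewrite /F; case: unpickle => [i|]; last exact: measure0.
  by case: ifPn => [_|/nS //]; exact: measure0.
have mE2 : measurable (E `&` [set w | k w \notin S]).
  by rewrite -FE; exact: bigcup_measurable.
have PE2 : P (E `&` [set w | k w \notin S]) = 0%E.
  apply: measure_negligible => //; rewrite -FE; apply: negligible_bigcup => n.
  by exists (F n); split; [exact: mF | exact: F0 | move=> w].
have EE : E = E1 `|` (E `&` [set w | k w \notin S]).
  apply/seteqP; split=> w /=; last by case=> -[].
  by move=> Ew; case: (boolP (k w \in S)) => kS; [left|right].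
split; first by rewrite EE; exact: measurableU.
rewrite [in LHS]EE measureU //; last first.
  by apply/seteqP; split=> w // -[[_ /= ki] [_ /=]]; rewrite ki.
rewrite [X in (_ + X)%E](_ : _ = 0%E) ?adde0; last exact: PE2.
by apply: (etrans PE1); apply: eq_big_seq => i iS; rewrite E1E.
Qed.
End Partition.

(** Taken at every real [q], also outside [0, 1], so that the law of the loop can be computed before
    the rates are bounded. *)
Definition uniform_cdf (R : realType) (q : R) : R :=
  fine (uniform_prob (@ltr01 R) `]-oo, q[%classic).

Lemma uniform_cdfE (R : realType) (q : R) : 0 <= q <= 1 -> uniform_cdf q = q.
Proof.
case/andP=> q0 q1; rewrite /uniform_cdf.
have mq : measurable (`]-oo, q[%classic : set R) by exact: measurable_itv.
have -> : uniform_prob (@ltr01 R) `]-oo, q[%classic =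
    (\int[uniform_prob (@ltr01 R)]_x (\1_(`]-oo, q[%classic : set R) x)%:E)%E.
  by rewrite integral_indic // setIT.
rewrite integral_uniform; last 2 first.
- exact/measurable_EFinP/measurable_indic.
- by move=> x; rewrite -[0%R]/(0%:E) lee_fin indicE ler0n.
rewrite subr0 invr1 mul1e integral_indic //= .
have -> : `]-oo, q[%classic `&` `[0, 1]%classic = `[0, q[%classic :> set R.
  apply/seteqP; split=> x /=; rewrite !in_itv /=.
    by case=> -> /andP[-> _].
  by case/andP=> x0 xq; rewrite xq x0 (ltW (lt_le_trans xq q1)).
rewrite lebesgue_measure_itv /= lte_fin; case: ltP => /= h; first by rewrite oppr0 addr0.
by apply/eqP; rewrite eq_le h q0.
Qed.

(** * Law of the loop driven by independent uniform variates *)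

Section Iterations.
Context (R : realType) (X : finType) (d : measure_display).
Context (Omega : measurableType d) (P : probability Omega R).
Variables (wr : seq X -> bool) (T : Omega -> forest X).
Variable eta : nat -> {RV P >-> R}.
Hypothesis mT : forall t, measurable (T @^-1` [set t]).
Hypothesis heta : fresh_uniforms T eta.

(** The events whose probability factorizes by independence. Each iteration splits such an event
    according to whether the next variate is below the current rate. *)
Definition history t n (A : nat -> set R) : set Omega :=
  [set w | T w = t /\ forall i, (i < n)%N -> A i (eta i w)].

Definition extend_history (A : nat -> set R) k (B : set R) : nat -> set R :=
  fun i => if i == k then B else A i.

Lemma historyS t k A B :
  history t k.+1 (extend_history A k B) = history t k A `&` eta k @^-1` B.
Proof.
apply/seteqP; split=> w /=.
  case=> Tw hA; split; first split=> // i ik.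
    by have := hA i (ltnW ik); rewrite /extend_history ltn_eqF.
  by have := hA k (ltnSn k); rewrite /extend_history eqxx.
case=> -[Tw hA] Bw; split=> // i; rewrite ltnS leq_eqVlt /extend_history.
by case: eqVneq => [->//|_] /=; exact: hA.
Qed.

Lemma measurable_history t n A : (forall i, measurable (A i)) ->
  measurable (history t n A).
Proof.
move=> mA; elim: n => [|n IHn].
  have -> : history t 0 A = T @^-1` [set t] by apply/seteqP; split=> w //= [].
  exact: mT.
have <- : extend_history A n (A n) = A.
  by apply/funext => i; rewrite /extend_history; case: eqVneq => [->|].
rewrite historyS; apply: measurableI => //.
by rewrite -[_ @^-1` _]setTI; exact: measurable_funP.
Qed.

Lemma prob_historyS t k A B : (forall i, measurable (A i)) -> measurable B ->
  P (history t k.+1 (extend_history A k B)) =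
  (P (history t k A) * uniform_prob (@ltr01 R) B)%E.
Proof.
move=> mA mB; have [hu hP] := heta.
rewrite /history !hP //; last by move=> i; rewrite /extend_history; case: ifP.
rewrite big_ord_recr /= muleA; congr (_ * _ * _)%E.
  by apply: eq_bigr => i _; rewrite /extend_history ltn_eqF.
by rewrite /extend_history eqxx hu.
Qed.

Lemma uniform_prob_lt (q : R) :
  uniform_prob (@ltr01 R) `]-oo, q[%classic = (uniform_cdf q)%:E.
Proof. by rewrite fineK // fin_num_measure. Qed.

Lemma uniform_prob_ge (q : R) :
  uniform_prob (@ltr01 R) `[q, +oo[%classic = (1 - uniform_cdf q)%:E.
Proof.
rewrite -setCitvl probability_setC; last exact: measurable_itv.
by rewrite [X in (_ - X)%E]uniform_prob_lt.
Qed.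

(** On each half of the split of the history by variate [k], the outcome of iteration [k] is
    constant, and the induction hypothesis applies to the extended history. This is why the sets [A]
    are arbitrary. *)
Lemma law_prob t n k v f A r : (forall i, measurable (A i)) ->
  let E := [set w | history t k A w
            /\ iterate wr (fun i => eta i w) n k v f = r] in
  measurable E /\
  P E = (P (history t k A)
         * (\sum_(p <- law wr (@uniform_cdf R) n v f | p.2 == r) p.1)%:E)%E.
Proof.
elim: n k v f A => [|n IHn] k v f A mA /=.
  rewrite big_cons big_nil /= addr0; case: eqP => vr.
    rewrite mule1; have -> : [set w | history t k A w /\ ([::], target v) = r] =
        history t k A by apply/seteqP; split=> w //= [].
    by split=> //; exact: measurable_history.
  have -> : [set w | history t k A w /\ ([::], target v) = r] = set0.
    by apply/seteqP; split=> w //= [].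
  by rewrite measure0 mule0.
set q := leaf_rate v f; rewrite big_cat /= (sum_branch _ _ (uniform_cdf q) _ (pred1 r)).
rewrite (sum_branch _ _ (1 - uniform_cdf q) _ (pred1 r)) /=.
pose next w (o : outcome R X) := match o with
  | Accepted s B => (s, B)
  | Rejected => ([::], target v)
  | Updated v' f' => iterate wr (fun i => eta i w) n k.+1 v' f' end.
have nextP o B : measurable B ->
    let E := [set w | (history t k A `&` eta k @^-1` B) w /\ next w o = r] in
    measurable E /\
    P E = (P (history t k A) * uniform_prob (@ltr01 R) B
      * (\sum_(p <- branch (law wr (@uniform_cdf R) n) v 1 o | p.2 == r) p.1)%:E)%E.
  move=> mB; have mA' i : measurable (extend_history A k B i).
    by rewrite /extend_history; case: ifP.
  rewrite -historyS -prob_historyS //.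
  (* The case of an outcome that ends the loop: the result is then a constant. *)
  have cst r' : let E := [set w | history t k.+1 (extend_history A k B) w /\ r' = r] in
      measurable E /\ P E = (P (history t k.+1 (extend_history A k B))
        * (\sum_(p <- [:: (1 : R, r')] | p.2 == r) p.1)%:E)%E.
    rewrite big_cons big_nil /= addr0; case: eqP => vr.
      rewrite mule1; have -> : [set w | history t k.+1 (extend_history A k B) w /\ r' = r]
        = history t k.+1 (extend_history A k B) by apply/seteqP; split=> w //= [].
      by split=> //; exact: measurable_history.
    have -> : [set w | history t k.+1 (extend_history A k B) w /\ r' = r] = set0.
      by apply/seteqP; split=> w //= [].
    by rewrite measure0 mule0.
  case: o => [s C||v' f'] /=; [exact: cst|exact: cst|].
  rewrite big_map /=; under [X in X%:E]eq_bigr do rewrite mul1r.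
  exact: IHn.
have [mlo Plo] := nextP (visit wr (q - 1) [::] v f) _ (measurable_itv `]-oo, q[).
have [mhi Phi] := nextP (visit wr q [::] v f) _ (measurable_itv `[q, +oo[).
set Elo := [set w | _ /\ next w (visit wr (q - 1) [::] v f) = r] in mlo Plo.
set Ehi := [set w | _ /\ next w (visit wr q [::] v f) = r] in mhi Phi.
have -> : [set w | history t k A w /\
    match visit wr (eta k w) [::] v f with
    | Accepted s B => (s, B)
    | Rejected => ([::], target v)
    | Updated v' f' => iterate wr (fun i => eta i w) n k.+1 v' f'
    end = r] = Elo `|` Ehi.
  apply/seteqP; split=> w /=.
    case=> hw; rewrite visitE -/q; case: ltP => qw E; [left|right].
      by split=> //; split=> //=; rewrite in_itv.
    by split=> //; split=> //=; rewrite in_itv /= qw.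
  by case=> -[[hw /=]]; rewrite in_itv /= ?andbT => qw E; split=> //;
    rewrite visitE -/q; move: qw; case: ltP.
split; first exact: measurableU.
rewrite measureU //; last first.
  apply/seteqP; split=> w // -[[[_ /= +] _] [[_ /= +] _]].
  by rewrite !in_itv /= andbT => /lt_le_trans /[apply]; rewrite ltxx.
have fh : P (history t k A) \is a fin_num.
  by apply: fin_num_measure; exact: measurable_history.
rewrite [X in (X + _)%E]Plo [X in (_ + X)%E]Phi uniform_prob_lt uniform_prob_ge.
by rewrite -(fineK fh) -!EFinM -EFinD; congr (_%:E); ring.
Qed.
End Iterations.

(** * Joint law of the tree and the result of the loop *)

Section Results.
Context (R : realType) (X : finType) (d : measure_display).
Context (Omega : measurableType d) (P : probability Omega R).
Variables (Ms Mb : seq X -> X -> R) (wr : seq X -> bool) (T : Omega -> forest X).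
Variable (eta : nat -> {RV P >-> R}).
Variables (result : Omega -> seq X * (X -> R)) (g : growth X).
Hypothesis mT : forall t, measurable (T @^-1` [set t]).
Hypothesis PT : forall t,
  P (T @^-1` [set t]) = (growth_prob Ms wr g [::] (Ms [::]) t)%:E.
Hypothesis heta : fresh_uniforms T eta.
Hypothesis hresult : forall w,
  result w = traversal Ms Mb wr (T w) (fun k => eta k w).

Definition tree_law t : seq (R * (seq X * (X -> R))) :=
  law wr (@uniform_cdf R) (nb_nodes t).+1 (root_cell Ms Mb)
    (initialize Ms Mb [::] (root_cell Ms Mb) t).

Let tree_prob t := growth_prob Ms wr g [::] (Ms [::]) t.

Lemma result_prob t r :
  measurable [set w | T w = t /\ result w = r] /\
  P [set w | T w = t /\ result w = r] =
  (tree_prob t * \sum_(p <- tree_law t | p.2 == r) p.1)%:E.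
Proof.
have [] := law_prob wr mT heta t (nb_nodes t).+1 0 (root_cell Ms Mb)
  (initialize Ms Mb [::] (root_cell Ms Mb) t) r (fun=> measurableT).
have -> : history T eta t 0 (fun=> setT) = T @^-1` [set t].
  by apply/seteqP; split=> w //= [].
rewrite PT -EFinM.
set E := (X in measurable X -> _); suff -> : [set w | T w = t /\ result w = r] = E.
  by move=> mE ->.
by apply/seteqP; split=> w /= [Tw rw]; split=> //; move: rw; rewrite hresult Tw.
Qed.

Lemma result_in_law w : result w \in [seq p.2 | p <- tree_law (T w)].
Proof. by rewrite hresult; exact: iterate_in_law. Qed.

(** Total probability over trees and results, where [gam B] is the conditional probability of [G]
    given the tree and the result (c, B). It serves for the whole space and for the events that fix
    [Y]. *)
Lemma chain_event (G : set Omega) (gam : (X -> R) -> R) (c : seq X) :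
  (forall t r, measurable [set w | [/\ T w = t, result w = r & G w]]) ->
  (forall t r, r.1 = c -> P [set w | [/\ T w = t, result w = r & G w]] =
    (P [set w | T w = t /\ result w = r] * (gam r.2)%:E)%E) ->
  measurable [set w | (result w).1 = c /\ G w] /\
  P [set w | (result w).1 = c /\ G w] = (\sum_(t <- growth_support g) tree_prob t *
          \sum_(p <- tree_law t | p.2.1 == c) p.1 * gam p.2.2)%:E.
Proof.
move=> mG PG; set E := [set w | (result w).1 = c /\ G w].
have Et t : measurable (E `&` [set w | T w = t]) /\
    P (E `&` [set w | T w = t]) = (tree_prob t *
      \sum_(p <- tree_law t | p.2.1 == c) p.1 * gam p.2.2)%:E.
  (* Results contain real functions and are not countable, but only these finitely many occur for
     the tree [t] and the chain [c]. *)
  pose S := undup [seq r <- [seq p.2 | p <- tree_law t] | r.1 == c].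
  have Er r : r \in S -> E `&` [set w | T w = t] `&` [set w | result w = r] =
      [set w | [/\ T w = t, result w = r & G w]].
    rewrite mem_undup mem_filter => /andP[/eqP rc _].
    apply/seteqP; split=> w /=; first by case=> -[[_ Gw] Tw] rw.
    by case=> Tw rw Gw; split=> //; split=> //; split=> //; rewrite rw.
  have [||r rS|mE ->] := @finite_partition _ _ _ P _ S result (E `&` [set w | T w = t]).
  - exact: undup_uniq.
  - move=> w [[rc _] /= Tw]; rewrite mem_undup mem_filter rc eqxx -Tw.
    exact: result_in_law.
  - by rewrite Er.
  split=> //.
  rewrite -(@sum_fibers _ _ _ (tree_law t) snd S) ?undup_uniq; last first.
  - move=> p pt pc; rewrite mem_undup mem_filter pc; exact: map_f.
  - by [].
  rewrite mulr_sumr -sumEFin; apply: eq_big_seq => r rS; rewrite Er //.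
  have rc : r.1 = c by move: rS; rewrite mem_undup mem_filter => /andP[/eqP].
  rewrite PG // (result_prob t r).2 -EFinM -mulrA mulr_suml; congr (_ * _)%:E.
  apply: eq_big => [p|p /eqP -> //].
  by apply/idP/andP => [/eqP ->|[]//]; rewrite rc.
have [t|t tS|mE ->] := @countable_partition _ _ _ P _ (growth_support g) T E (growth_support_uniq g).
- exact: (Et t).1.
- by rewrite (Et t).2 /tree_prob growth_prob_support ?mul0r.
- split=> //; rewrite -sumEFin; apply: eq_bigr => t _; exact: (Et t).2.
Qed.
End Results.

(** * Path probabilities and payoffs of extended sequences *)

Section Paths.
Variables (R : realType) (X : finType) (Mb : seq X -> X -> R).

Lemma path_prob_rcons c z y :
  path_prob Mb c (rcons z y) = path_prob Mb c z * Mb (c ++ z) y.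
Proof.
elim: z c => [|x z IHz] c /=; first by rewrite cats0 mulr1 mul1r.
by rewrite IHz mulrA cat_rcons.
Qed.

(** The position of the last token decides its law: after the additional token it comes from [Mb],
    at the place of the additional token from [B] ([pay_last]), and within the accepted chain it is
    determined ([pay_short]). *)
Lemma pay_rcons c z y s B : (size s < size z)%N ->
  pay Mb c (rcons z y) s B = pay Mb c z s B * Mb (c ++ z) y.
Proof.
elim: s c z => [|t s IHs] c [|x z] //=.
  by move=> _; rewrite path_prob_rcons cat_rcons mulrA.
rewrite ltnS => sz; case: eqVneq => [->|_]; last by rewrite !mul0r.
by rewrite IHs // cat_rcons mulrA.
Qed.

Lemma pay_short c z s B : (size z <= size s)%N ->
  pay Mb c z s B = (z == take (size z) s)%:R.
Proof.
elim: s c z => [|t s IHs] c [|x z] //=.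
  by rewrite IHs //= take0 mul1r.
by rewrite ltnS => zs; rewrite IHs // eqseq_cons -natrM mulnb.
Qed.

Lemma pay_last c z y s B : size z = size s ->
  pay Mb c (rcons z y) s B = (z == s)%:R * B y.
Proof.
elim: s c z => [|t s IHs] c [|x z] //=; first by rewrite mulr1 mul1r.
by case=> zs; rewrite IHs // mulrA eqseq_cons -natrM mulnb.
Qed.

Lemma path_prob_prod c n (z : n.-tuple X) :
  path_prob Mb c z = \prod_(i < n) Mb (c ++ take i z) (tnth z i).
Proof.
elim: n c z => [|n IHn] c z; first by rewrite tuple0 big_ord0.
case: (tupleP z) => x z' /=; rewrite big_ord_recl /= cats0 tnth0 IHn.
by congr (_ * _); apply: eq_bigr => i _; rewrite tnthS /= cat_rcons.
Qed.

Lemma sum_path_prob c n : (forall c, \sum_x Mb c x = 1) ->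
  \sum_(z : n.-tuple X) path_prob Mb c z = 1.
Proof.
move=> Mb1; elim: n c => [|n IHn] c.
  by rewrite (big_pred1 [tuple]) // => z; rewrite [z]tuple0; apply/esym/eqP; exact: val_inj.
rewrite (reindex (fun p : X * n.-tuple X => [tuple of p.1 :: p.2])) /=; last first.
  exists (fun z : n.+1.-tuple X => (thead z, [tuple of behead z])) => [[x z]|z] _ /=.
    by congr pair; exact: val_inj.
  by rewrite [RHS]tuple_eta.
rewrite -(pair_bigA _ (fun x (z : n.-tuple X) =>
  Mb c x * path_prob Mb (rcons c x) z)) /= -[RHS](Mb1 c).
by apply: eq_bigr => x _; rewrite -mulr_sumr IHn mulr1.
Qed.

End Paths.

Lemma measurable_mkseq (X : eqType) (d : measure_display)
    (Omega : measurableType d) (Z : nat -> Omega -> X) n z :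
  (forall i x, measurable (Z i @^-1` [set x])) ->
  measurable [set w | mkseq (Z^~ w) n = z].
Proof.
move=> mZ; elim: n z => [|n IHn] z.
  have [->|z0] := eqVneq z [::].
    by rewrite (_ : [set w | _] = setT) //; apply/seteqP.
  rewrite (_ : [set w | _] = set0) //; apply/seteqP; split=> w //= z0'.
  by move: z0; rewrite -z0' eqxx.
case: (lastP z) => [|s x].
  rewrite (_ : [set w | _] = set0) //; apply/seteqP; split=> w //=.
rewrite (_ : [set w | _] = [set w | mkseq (Z^~ w) n = s] `&` Z n @^-1` [set x]).
  exact: measurableI.
apply/seteqP; split=> w /=; rewrite mkseqS.
  by move/rcons_inj => -[].
by case=> -> ->.
Qed.

(** * Finite-dimensional laws of the continued output *)

Section Output.
Context (R : realType) (X : finType) (d : measure_display).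
Context (Omega : measurableType d) (P : probability Omega R).
Variables (Ms Mb : seq X -> X -> R) (wr : seq X -> bool) (T : Omega -> forest X).
Variable eta : nat -> {RV P >-> R}.
Variables (result : Omega -> seq X * (X -> R)) (g : growth X).
Variables (Y : Omega -> X) (Z : nat -> Omega -> X).
Hypothesis hMs : forall s, (forall x, 0 <= Ms s x) /\ \sum_x Ms s x = 1.
Hypothesis hMb : forall s, (forall x, 0 <= Mb s x) /\ \sum_x Mb s x = 1.
Hypothesis mT : forall t, measurable (T @^-1` [set t]).
Hypothesis PT : forall t,
  P (T @^-1` [set t]) = (growth_prob Ms wr g [::] (Ms [::]) t)%:E.
Hypothesis heta : fresh_uniforms T eta.
Hypothesis hresult : forall w,
  result w = traversal Ms Mb wr (T w) (fun k => eta k w).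
Hypothesis hY : sampled_from P T result Y.
Hypothesis hZ : continuation P Mb (fun w => (result w).1) Y Z.

Let tree_prob t := growth_prob Ms wr g [::] (Ms [::]) t.
Let tlaw t := tree_law Ms Mb wr t.

(** Fixing the accepted chain fixes the place of [Y] in the output, so the law can be built by
    appending one token at a time to [z]. *)
Lemma chain_Z_event (c z : seq X) :
  let E := [set w | (result w).1 = c /\ mkseq (Z^~ w) (size z) = z] in
  measurable E /\
  P E = (\sum_(t <- growth_support g) tree_prob t *
    \sum_(p <- tlaw t | p.2.1 == c) p.1 * pay Mb [::] z c p.2.2)%:E.
Proof.
have [mZ Zout Zstep] := hZ; have [mY PY] := hY.
have mr t r : measurable [set w | T w = t /\ result w = r].
  exact: (result_prob mT PT heta hresult t r).1.
have chainP : measurable [set w | (result w).1 = c /\ setT w] /\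
    P [set w | (result w).1 = c /\ setT w] =
    (\sum_(t <- growth_support g) tree_prob t *
       \sum_(p <- tlaw t | p.2.1 == c) p.1 * 1)%:E.
  have trE t r : [set w | [/\ T w = t, result w = r & setT w]] =
      [set w | T w = t /\ result w = r] by apply/seteqP; split=> w /= [].
  apply: (chain_event mT PT heta hresult (gam := fun=> 1)) => t r.
    by rewrite trE.
  by rewrite trE mule1.
have mE0 s : measurable [set w | (result w).1 = c /\ mkseq (Z^~ w) (size s) = s].
  rewrite (_ : [set w | _] = [set w | (result w).1 = c /\ setT w]
    `&` [set w | mkseq (Z^~ w) (size s) = s]).
    by apply: measurableI; [exact: chainP.1 | exact: measurable_mkseq].
  by apply/seteqP; split=> w /=; [case | case=> -[]].
elim/last_ind: z => [|z y IHz] E; (split; first exact: mE0).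
  rewrite (_ : E = [set w | (result w).1 = c /\ setT w]); last first.
    by apply/seteqP; split=> w /= [].
  rewrite chainP.2; congr (_%:E); apply: eq_bigr => t _; congr (_ * _).
  by apply: eq_bigr => p _; rewrite pay_short //= take0.
(* The new token [y] is the additional token if [z] and [c] have equal sizes (treated first), lies
   in the accepted chain if [z] is shorter, and in the continuation if [z] is longer. *)
rewrite /E size_rcons; case: (ltngtP (size z) (size c)) => zc; last 1 first.
- have [zE|zE] := eqVneq z c; last first.
    rewrite (_ : [set w | _] = set0) ?measure0; last first.
      apply/seteqP; split=> w //= -[rc]; rewrite zc -rc Zout.
      by move/rcons_inj => -[cz _]; move: zE; rewrite -cz rc eqxx.
    rewrite big1 // => t _; rewrite big1 ?mulr0 // => p _.
    by rewrite pay_last // (negPf zE) mul0r mulr0.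
  subst z.
  have [||_ PE] := chain_event mT PT heta hresult
    (G := [set w | Y w = y]) (gam := fun B => B y) (c := c).
  - move=> t r; rewrite (_ : [set w | _] = [set w | T w = t /\ result w = r]
      `&` Y @^-1` [set y]); first exact: measurableI.
    by apply/seteqP; split=> w /=; [case | case=> -[]].
  - by move=> t [c' B] _; exact: PY.
  rewrite (_ : [set w | _] = [set w | (result w).1 = c /\ [set w | Y w = y] w]).
    rewrite PE; congr (_%:E); apply: eq_bigr => t _; congr (_ * _).
    by apply: eq_bigr => p _; rewrite pay_last // eqxx mul1r.
  apply/seteqP; split=> w /= [rc]; first by rewrite -rc Zout => /rcons_inj [].
  by move=> Yw; split=> //; rewrite -rc Zout Yw.
- have [zE|zE] := eqVneq (rcons z y) (take (size z).+1 c); last first.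
    rewrite (_ : [set w | _] = set0) ?measure0; last first.
      apply/seteqP; split=> w //= -[rc zw]; move: zE; rewrite -zw.
      have := congr1 (take (size z).+1) (Zout w).
      rewrite rc -cats1 takel_cat // => <-.
      by rewrite -map_take take_iota (minn_idPl _) ?eqxx // ltnW.
    rewrite big1 // => t _; rewrite big1 ?mulr0 // => p _.
    by rewrite pay_short size_rcons // (negPf zE) mulr0.
  rewrite (_ : [set w | _] = [set w | (result w).1 = c /\ setT w]); last first.
    apply/seteqP; split=> w /= [rc] // _; split=> //.
    have := congr1 (take (size z).+1) (Zout w).
    rewrite rc -cats1 takel_cat // -zE => <-.
    by rewrite -map_take take_iota (minn_idPl _) // ltnW.
  rewrite chainP.2; congr (_%:E); apply: eq_bigr => t _; congr (_ * _).
  by apply: eq_bigr => p _; rewrite pay_short size_rcons // zE eqxx.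
- rewrite Zstep // IHz.2 -EFinM mulr_suml; congr (_%:E).
  apply: eq_bigr => t _; rewrite -mulrA mulr_suml; congr (_ * _).
  by apply: eq_bigr => p _; rewrite pay_rcons // mulrA.
Qed.

Lemma Z_event (z : seq X) :
  let E := [set w | mkseq (Z^~ w) (size z) = z] in
  P E = (\sum_(t <- growth_support g) tree_prob t *
    \sum_(p <- tlaw t) p.1 * pay Mb [::] z p.2.1 p.2.2)%:E.
Proof.
(* The chains that some tree of the support can produce; the event of any other chain has
   probability 0. *)
move=> E; pose S := undup (flatten
  [seq [seq p.2.1 | p <- tlaw t] | t <- growth_support g]).
have Ec c : E `&` [set w | (result w).1 = c] =
    [set w | (result w).1 = c /\ mkseq (Z^~ w) (size z) = z].
  by apply/seteqP; split=> w /= [].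
have inS t p : t \in growth_support g -> p \in tlaw t -> p.2.1 \in S.
  move=> tS pt; rewrite mem_undup; apply/flatten_mapP; exists t => //.
  by apply/mapP; exists p.
have [c|c cS|_ ->] := @countable_partition _ _ _ P _ S (fun w => (result w).1) E
  (undup_uniq _).
- by rewrite Ec; exact: (chain_Z_event c z).1.
- rewrite Ec (chain_Z_event c z).2 big_seq big1 // => t tS.
  rewrite big_seq_cond big1 ?mulr0 // => p /andP[pt /eqP pc].
  by move: cS; rewrite -pc (inS t).
under eq_bigr do rewrite Ec (chain_Z_event _ z).2.
rewrite sumEFin exchange_big; congr (_%:E); apply: eq_big_seq => t tS /=.
rewrite -mulr_sumr; congr (_ * _).
rewrite -[RHS](@sum_fibers _ _ _ _ (fun p => p.2.1) S) ?undup_uniq //; last first.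
  by move=> p pt _; exact: (inS t).
by apply: eq_bigr => c _; apply: eq_bigr => p /= /eqP <-.
Qed.

Lemma Z_event_le (z : seq X) : (0 < size z)%N ->
  (P [set w | mkseq (Z^~ w) (size z) = z] <= (path_prob Mb [::] z)%:E)%E.
Proof.
move=> z0; rewrite Z_event lee_fin.
have Ms0 c x : 0 <= Ms c x by have [] := hMs c.
have Ms1 c : \sum_x Ms c x = 1 by have [] := hMs c.
have Mb0 c x : 0 <= Mb c x by have [] := hMb c.
have Mb1 c : \sum_x Mb c x = 1 by have [] := hMb c.
pose v := root_cell Ms Mb.
have hv : cell_law v.
  split=> //=; rewrite ?ler01 ?lexx ?Mb1 ?mul1r //.
  exact: draft_law_Ms.
pose phi (r : seq X * (X -> R)) := 1 * pay Mb [::] z r.1 r.2.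
pose rho B := phi ([::], B).
rewrite (eq_bigr (fun t => tree_prob t *
    value Ms Mb wr (@uniform_cdf R) [::] v t phi rho)); last first.
  move=> t _; congr (_ * _).
  rewrite -state_value_initialize -(@law_value _ _ _ _ _ _ (nb_nodes t).+1)
    ?nb_nodes_initialize //.
    by apply: eq_bigr => p _; rewrite /phi mul1r.
  exact: reachable_initialize.
rewrite sum_support.
(* At the root p = 1, so the term (1 - p) K disappears and K = 1 serves as a bound for the
   payoff. *)
have := @mean_value_le R X Ms Mb wr (@uniform_cdf R) Ms0 Ms1 Mb0 Mb1
  (@uniform_cdfE R) g [::] z v 1 rho 1 hv ler01 ler01.
rewrite subrr mul0r addr0 !mul1r sum_Mb_weight //; apply.
  by move=> B B0; rewrite /rho /phi mul1r pay_ge0.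
move=> B B0 B1; rewrite /rho /phi mul1r /=; case: (z) => [|x z']; first exact: lexx.
have Bx : B x <= 1.
  by apply: le_trans B1; rewrite (bigD1 x) //= lerDl sumr_ge0.
apply: mulr_ile1 => //; first exact: path_prob_ge0.
have := sum_path_prob (rcons [::] x) (size z') Mb1.
rewrite (bigD1 (in_tuple z')) //= => <-.
by rewrite lerDl sumr_ge0 // => i _; exact: path_prob_ge0.
Qed.

Lemma Z_event_eq n (z : n.-tuple X) : (0 < n)%N ->
  P [set w | mkseq (Z^~ w) n = z] = (path_prob Mb [::] z)%:E.
Proof.
move=> n0; have [mZ _ _] := hZ.
have Mb1 c : \sum_x Mb c x = 1 by have [] := hMb c.
pose E (s : n.-tuple X) := [set w | mkseq (Z^~ w) n = s].
have mE s : measurable (E s) by exact: measurable_mkseq.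
have fE s : P (E s) \is a fin_num by exact: fin_num_measure.
have leE s : fine (P (E s)) <= path_prob Mb [::] s.
  rewrite -lee_fin fineK //; have := @Z_event_le s.
  by rewrite size_tuple; apply.
pose kap w : n.-tuple X := [tuple Z i w | i < n].
have kapE s : [set: Omega] `&` [set w | kap w = s] = E s.
  have kw w : tval (kap w) = mkseq (Z^~ w) n.
    by rewrite /mkseq -val_enum_ord -map_comp.
  rewrite setTI; apply/seteqP; split=> w /=; first by rewrite /E /= -kw => ->.
  by rewrite /E /= -kw => /val_inj.
(* The first [n] tokens partition the whole space, so their probabilities sum to 1, like the path
   probabilities that bound them. *)
have [||s _|_] := @finite_partition _ _ _ P _ (enum {: n.-tuple X}) kap setT.
- exact: enum_uniq.
- by move=> w _; rewrite mem_enum.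
- by rewrite kapE.
rewrite probability_setT big_enum /= => E1.
have sumE : \sum_(s : n.-tuple X) (path_prob Mb [::] s - fine (P (E s))) = 0.
  rewrite sumrB sum_path_prob //; apply/eqP; rewrite subr_eq0 eq_sym; apply/eqP.
  apply: EFin_inj; rewrite E1 -sumEFin.
  by apply: eq_bigr => s _; rewrite kapE fineK.
have /psumr_eq0P/(_ z isT) := sumE.
move=> H; rewrite -[LHS](fineK (fE z)); congr (_%:E).
by apply/esym/subr0_eq; apply: H => s _; rewrite subr_ge0.
Qed.
End Output.

Theorem theorem3p3 (R : realType) (X : finType) (Prefix : Type)
    (Ms Mb : Prefix -> seq X -> X -> R)
    (hMs : autoregressive Ms) (hMb : autoregressive Mb)
    (X0 : Prefix) (wr : seq X -> bool)
    (d : measure_display) (Omega : measurableType d) (P : probability Omega R)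
    (T : Omega -> forest X) (hT : decoding_tree (Ms X0) wr P T)
    (eta : nat -> {RV P >-> R}) (heta : fresh_uniforms T eta)
    (result : Omega -> seq X * (X -> R))
    (hresult : forall w,
       result w = traversal (Ms X0) (Mb X0) wr (T w) (fun k => eta k w))
    (Y : Omega -> X) (hY : sampled_from P T result Y) :
  (forall w, is_chain (T w) (result w).1) /\
  (forall Z : nat -> Omega -> X,
     continuation P (Mb X0) (fun w => (result w).1) Y Z ->
     forall (n : nat) (z : n.-tuple X), (0 < n)%N ->
       P [set w | mkseq (Z^~ w) n = z]
       = (\prod_(i < n) Mb X0 (take i z) (tnth z i))%:E).
Proof.
have [g hg] := hT; split=> [w|Z hZ n z n0].
  (* The tree is written as its own initialization with the cells stripped, the form that
     [iterate_chain] treats. *)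
  rewrite hresult -[X in is_chain X](initializeK (Ms X0) (Mb X0) [::]
    (root_cell (Ms X0) (Mb X0)) (T w)).
  exact: iterate_chain.
rewrite (Z_event_eq (hMs X0) (hMb X0) (fun t => (hg t).1) (fun t => (hg t).2)
  heta hresult hY hZ) //.
by rewrite path_prob_prod.
Qed.
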